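(* Let $G$ be a graph. If $G$ is a forest, then the independence complex $I(G)$ is s-vertex-decomposable.
   Context: Graphs are finite, undirected, without loops or multiple edges. A forest is a graph containing no cycle $C_n$ ($n\ge3$) as a full (induced) subgraph. The independence complex is $I(G)=\{\sigma\subset V(G): uv\notin E(G)\text{ for any }u,v\in\sigma\}$. A simplicial complex $K$ is a finite abstract collection of subsets of a finite set $V(K)$, containing $\emptyset$ and closed under taking subsets; a vertex of $K$ is an element $v$ with $\{v\}\in K$. $K$ is called a simplex if it consists of all subsets of some non-empty finite set. For a vertex $v$ of $K$ put $\mathrm{st}_K(v)=\{\sigma\in K: \sigma\cup\{v\}\in K\}$, $\mathrm{dl}_K(v)=\{\sigma\in K: v\notin\sigma\}$, $\mathrm{lk}_K(v)=\{\sigma\in K: \sigma\cup\{v\}\in K,\ v\notin\sigma\}$. s-vertex-decomposable (recursive definition): $K$ is s-vertex-decomposable if either $K$ is a simplex or $K=\{\emptyset\}$, or there exist vertices $v,w$ of $K$ such that $\mathrm{dl}_K(v)$ and $\mathrm{lk}_K(v)$ are s-vertex-decomposable and $\mathrm{dl}_K(v)=\mathrm{st}_K(w)$. *)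

(* Defs.v *)
From mathcomp Require Import all_boot.

Set Implicit Arguments.
Unset Strict Implicit.
Unset Printing Implicit Defensive.

Record sgraph := SGraph {
  svertex :> finType;
  adj : rel svertex;
  adj_sym : symmetric adj;
  adj_irr : irreflexive adj
}.

(* Adjacency of C_n on {0, ..., n-1}; ordS is the successor modulo n. *)
Definition cycle_adj (n : nat) : rel 'I_n :=
  fun i j => (j == ordS i) || (i == ordS j).

Definition has_full_cycle (G : sgraph) (n : nat) : Prop :=
  exists f : 'I_n -> G,
    injective f /\ forall i j : 'I_n, adj (f i) (f j) = cycle_adj i j.

Definition forest (G : sgraph) : Prop :=
  forall n : nat, 3 <= n -> ~ has_full_cycle G n.

(* Complexes are families of subsets of a fixed finite type T. Elements of T
   need not be vertices, so links and deletions stay on the same T. *)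
Definition simplicial_complex (T : finType) (K : {set {set T}}) : Prop :=
  set0 \in K /\ forall s t : {set T}, s \in K -> t \subset s -> t \in K.

Definition vertex (T : finType) (K : {set {set T}}) (v : T) : Prop :=
  [set v] \in K.

Definition simplex (T : finType) (K : {set {set T}}) : Prop :=
  exists2 A : {set T}, A != set0 & K = powerset A.

Definition star (T : finType) (K : {set {set T}}) (v : T) : {set {set T}} :=
  [set s in K | v |: s \in K].

Definition deletion (T : finType) (K : {set {set T}}) (v : T) :
    {set {set T}} :=
  [set s in K | v \notin s].

Definition link (T : finType) (K : {set {set T}}) (v : T) : {set {set T}} :=
  [set s in K | (v |: s \in K) && (v \notin s)].

Inductive s_vertex_decomposable (T : finType) : {set {set T}} -> Prop :=
| svd_simplex (K : {set {set T}}) :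
    simplex K -> s_vertex_decomposable K
| svd_empty :
    s_vertex_decomposable [set set0]
| svd_step (K : {set {set T}}) (v w : T) :
    simplicial_complex K -> vertex K v -> vertex K w ->
    s_vertex_decomposable (deletion K v) ->
    s_vertex_decomposable (link K v) ->
    deletion K v = star K w ->
    s_vertex_decomposable K.

Definition independence_complex (G : sgraph) : {set {set G}} :=
  [set s : {set G} | [forall u in s, forall v in s, ~~ adj u v]].

Lemma independence_complexP (G : sgraph) (s : {set G}) :
  reflect (forall u v : G, u \in s -> v \in s -> ~~ adj u v)
          (s \in independence_complex G).
Proof.
rewrite inE; apply: (iffP forall_inP) => [H u v us vs | H u us].
  exact: (forall_inP (H u us)).
by apply/forall_inP => v vs; apply: H.
Qed.

Lemma independence_complex_complex (G : sgraph) :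
  simplicial_complex (independence_complex G).
Proof.
split=> [|s t /independence_complexP Hs /subsetP ts].
  by apply/independence_complexP => u v; rewrite inE.
by apply/independence_complexP => u v /ts us /ts vs; apply: Hs.
Qed.

(* Main.v *)
Require Import Defs.
From mathcomp Require Import all_boot.

Set Implicit Arguments.
Unset Strict Implicit.
Unset Printing Implicit Defensive.

(** The complexes I(G[A]) of the induced subgraphs G[A] are treated together,
    by induction on the size of A, inside the fixed vertex type of G.

    If G[A] has no edge, I(G[A]) is the full powerset of A: a simplex, or
    {set0} when A is empty.  Otherwise G[A] has a leaf w
    ([forest_leaf]); let v be its unique neighbour in A.  Deleting v leaves w
    isolated, so a face of I(G[A]) avoids v exactly when w can be added to it:
    the deletion of v is the star of w.  Deletion and link of v are themselves
    the complexes of A minus v and of A minus the closed neighbourhood of v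
    ([deletion_indep_in], [link_indep_in]), and the induction applies.

    The leaf is found by growing an induced path inside A.  Were there no leaf,
    the head of the path would have a neighbour y in A besides the second
    vertex.  If y is adjacent to no further vertex of the path, the path
    extends by y; otherwise the first such vertex closes an induced cycle with
    y ([induced_path_closes]), which a forest forbids.  So induced paths of
    every length would exist, contradicting finiteness. *)

(** * Induced paths and leaves *)

Definition induced_path (G : sgraph) (x0 : G) (s : seq G) : Prop :=
  uniq s /\ forall i j, i < j -> j < size s ->
    adj (nth x0 s i) (nth x0 s j) = (j == i.+1).

Lemma cycle_adj_lt n (i j : 'I_n) : i < j ->
  cycle_adj i j = (j == i.+1 :> nat) || ((i == 0 :> nat) && (j.+1 == n)).
Proof.
move=> lt_ij; rewrite /cycle_adj -!val_eqE /=.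
have lt_in : i.+1 < n by apply: leq_ltn_trans (ltn_ord j).
rewrite modn_small //; congr (_ || _).
have [jn|jn] := eqVneq j.+1 n; first by rewrite jn modnn andbT.
have lt_jn : j.+1 < n by rewrite ltn_neqAle jn ltn_ord.
by rewrite modn_small // andbF ltn_eqF // ltnS ltnW.
Qed.

Lemma cycle_adj_sym n : symmetric (@cycle_adj n).
Proof. by move=> i j; rewrite /cycle_adj orbC. Qed.

Lemma cycle_adj_irr n : 1 < n -> irreflexive (@cycle_adj n).
Proof.
move=> n_gt1 i; rewrite /cycle_adj orbb -val_eqE /=.
have [in_|in_] := eqVneq i.+1 n.
  by rewrite in_ modnn; apply: gtn_eqF; rewrite -ltnS in_.
by rewrite modn_small ?ltn_eqF // ltn_neqAle in_ ltn_ord.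
Qed.

(** Adjacency is symmetric and irreflexive on both sides, so a full cycle can
    be recognised from the pairs of increasing indices alone.  The cycle may
    use only a prefix of s, so a path need not be cut where it is closed. *)
Lemma full_cycle_nth (G : sgraph) (x0 : G) n (s : seq G) :
  1 < n -> n <= size s -> uniq s ->
  (forall i j, i < j -> j < n ->
    adj (nth x0 s i) (nth x0 s j) =
      (j == i.+1) || ((i == 0) && (j.+1 == n))) ->
  has_full_cycle G n.
Proof.
move=> n_gt1 le_ns s_uniq s_adj.
have lt_s (i : 'I_n) : i < size s by apply: leq_trans le_ns.
exists (fun i : 'I_n => nth x0 s i); split=> [i j /eqP|i j].
  by rewrite nth_uniq // => /eqP/val_inj.
case: (ltngtP i j) => [lt_ij|lt_ji|/val_inj->].
- by rewrite cycle_adj_lt // s_adj.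
- by rewrite adj_sym cycle_adj_sym cycle_adj_lt // s_adj.
- by rewrite adj_irr cycle_adj_irr.
Qed.

(** The head of an induced path has no neighbour on the path but the second
    vertex, so any other neighbour lies off the path and can extend it. *)
Lemma neighbour_notin_path (G : sgraph) (x0 y : G) s :
  induced_path x0 s -> adj y (nth x0 s 0) -> y != nth x0 s 1 -> y \notin s.
Proof.
move=> [_ s_adj] y_adj y_neq1; apply/negP => y_s.
have lt_is : index y s < size s by rewrite index_mem.
move: y_adj y_neq1; rewrite -{1 2}(nth_index x0 y_s).
case: (index y s) lt_is => [|i] lt_is; first by rewrite adj_irr.
by rewrite adj_sym s_adj // => /eqP->; rewrite eqxx.
Qed.

(** Taking the first neighbour of y beyond the head is what makes the cycle
    chordless: y misses all the path vertices in between. *)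
Lemma induced_path_closes (G : sgraph) (x0 y x : G) (s : seq G) :
  induced_path x0 (x :: s) -> y \notin x :: s -> adj y x -> has (adj y) s ->
  has_full_cycle G (find (adj y) s).+3.
Proof.
move=> [xs_uniq xs_adj] y_xs y_x y_s.
have lt_fs : find (adj y) s < size s by rewrite -has_find.
apply: (@full_cycle_nth _ x0 _ [:: y, x & s]); rewrite //= ?y_xs //.
move=> [|i] [|[|j]] //= lt_ij lt_jf.
  rewrite !eqSS; move: lt_jf; rewrite !ltnS leq_eqVlt => /predU1P[->|lt_jf].
    by rewrite eqxx nth_find.
  by rewrite ltn_eqF // before_find.
rewrite (xs_adj i j.+1) ?orbF //=.
by rewrite ltnS; apply: leq_ltn_trans lt_fs; rewrite -ltnS.
Qed.

Lemma induced_path_cons (G : sgraph) (x0 y x : G) s :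
  induced_path x0 (x :: s) -> y \notin x :: s -> adj y x ->
  ~~ has (adj y) s -> induced_path x0 [:: y, x & s].
Proof.
move=> [xs_uniq xs_adj] y_xs y_x /hasPn y_s.
split=> [|[|i] [|[|j]] //= lt_ij lt_js]; first by rewrite /= y_xs.
- by apply/negbTE/y_s/mem_nth.
- exact: (xs_adj i j.+1).
Qed.

Lemma forest_leaf (G : sgraph) (A : {set G}) (a b : G) :
  forest G -> a \in A -> b \in A -> adj a b ->
  exists w v, [/\ w \in A, v \in A, adj w v &
                  forall x, x \in A -> adj w x -> x = v].
Proof.
move=> hG aA bA ab.
have [|noleaf] := boolP [exists w in A, exists v in A,
    adj w v && [forall x in A, adj w x ==> (x == v)]].
  case/exists_inP=> w wA /exists_inP[v vA /andP[wv /forall_inP wE]].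
  by exists w, v; split=> // x xA wx; apply/eqP; move: (wE x xA); rewrite wx.
have other w v : w \in A -> v \in A -> adj w v ->
    exists y, [/\ y \in A, adj w y & y != v].
  move=> wA vA wv; move: noleaf; rewrite negb_exists_in.
  move/forall_inP/(_ w wA); rewrite negb_exists_in.
  move/forall_inP/(_ v vA); rewrite wv /= negb_forall_in.
  by case/exists_inP=> y yA; rewrite negb_imply => /andP[wy yv]; exists y.
(* Paths start with at least two vertices, so that the head x has a known
   neighbour z for [other] to avoid. *)
have long n : exists x z s,
    [/\ induced_path a [:: x, z & s], all [in A] [:: x, z & s] & size s = n].
  elim: n => [|n [x [z [s [xzs_path xzs_A sz]]]]].
    exists a, b, [::]; split; rewrite //= ?aA ?bA //; split.
      by rewrite /= inE andbT; apply: contraTneq ab => ->; rewrite adj_irr.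
    by move=> [|i] [|[|j]].
  have /and3P[xA zA _] := xzs_A.
  have xz : adj x z by have [_ /(_ 0 1 isT isT)] := xzs_path.
  have [y [yA xy yz]] := other x z xA zA xz.
  have yx : adj y x by rewrite adj_sym.
  have y_xzs := neighbour_notin_path xzs_path yx yz.
  have [y_zs|y_zs] := boolP (has (adj y) (z :: s)).
    by case: (hG _ _ (induced_path_closes xzs_path y_xzs yx y_zs)).
  exists y, x, (z :: s); split; last by rewrite /= sz.
    exact: induced_path_cons.
  by rewrite /= yA.
have [x [z [s [[xzs_uniq _] _ sz]]]] := long #|G|.
have /= xzs_card := card_uniqP xzs_uniq.
by have := max_card [in [:: x, z & s]]; rewrite xzs_card sz ltnNge leqnSn.
Qed.

(** * Independence complexes of induced subgraphs *)

(** This is I(G[A]), kept on the vertex type of G so that the induction on A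
    does not change the ambient type. *)
Definition indep_in (G : sgraph) (A : {set G}) : {set {set G}} :=
  [set s in independence_complex G | s \subset A].

Lemma indep_inP (G : sgraph) (A s : {set G}) :
  reflect ((forall x y, x \in s -> y \in s -> ~~ adj x y) /\ s \subset A)
          (s \in indep_in A).
Proof.
by rewrite inE; apply: (iffP andP) => -[/independence_complexP].
Qed.

Lemma indep_in_complex (G : sgraph) (A : {set G}) :
  simplicial_complex (indep_in A).
Proof.
have [I0 I_down] := independence_complex_complex G.
split=> [|s t]; first by rewrite inE I0 sub0set.
rewrite [s \in _]inE [t \in _]inE => /andP[sI sA] ts.
by rewrite (subset_trans ts sA) andbT; apply: I_down ts.
Qed.

Lemma vertex_indep_in (G : sgraph) (A : {set G}) (v : G) :
  v \in A -> vertex (indep_in A) v.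
Proof.
move=> vA; apply/indep_inP; split; last by rewrite sub1set.
by move=> x y /set1P-> /set1P->; rewrite adj_irr.
Qed.

Lemma indep_in_cons (G : sgraph) (A s : {set G}) (v : G) :
  (v |: s \in indep_in A) =
    [&& s \in indep_in A, v \in A & [forall x in s, ~~ adj v x]].
Proof.
apply/indep_inP/and3P=> [[indep]|[/indep_inP[indep sA] vA /forall_inP vs]].
  rewrite subUset sub1set => /andP[vA sA]; split=> //.
    by apply/indep_inP; split=> // x y xs ys; apply: indep; rewrite setU1r.
  by apply/forall_inP => x xs; apply: indep; rewrite ?setU11 ?setU1r.
split=> [x y|]; last by rewrite subUset sub1set vA.
case/setU1P=> [->|xs] /setU1P[->|ys]; rewrite ?adj_irr ?vs //.
- by rewrite adj_sym vs.
- exact: indep.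
Qed.

Lemma deletion_indep_in (G : sgraph) (A : {set G}) (v : G) :
  deletion (indep_in A) v = indep_in (A :\ v).
Proof. by apply/setP => s; rewrite !inE subsetD1 andbA. Qed.

Lemma link_indep_in (G : sgraph) (A : {set G}) (v : G) : v \in A ->
  link (indep_in A) v =
    indep_in [set x in A | (x != v) && ~~ adj v x].
Proof.
move=> vA; apply/setP => s; rewrite [LHS]inE indep_in_cons vA /=.
apply/and3P/indep_inP.
  case=> /indep_inP[indep /subsetP sA] /andP[_ /forall_inP vs] v_s; split=> //.
  apply/subsetP => x xs; rewrite inE sA // vs // andbT.
  by apply: contraNneq v_s => <-.
case=> indep /subsetP sub.
have sI : s \in indep_in A.
  by apply/indep_inP; split=> //; apply/subsetP => x /sub; rewrite inE => /andP[].
split=> //; last by apply/negP => /sub; rewrite !inE eqxx andbF.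
by rewrite sI; apply/forall_inP => x /sub; rewrite inE => /and3P[].
Qed.

(** Since v is the only vertex of A adjacent to w, it is the only obstruction
    to adding w to a face. *)
Lemma deletion_eq_star_leaf (G : sgraph) (A : {set G}) (w v : G) :
  w \in A -> adj w v -> (forall x, x \in A -> adj w x -> x = v) ->
  deletion (indep_in A) v = star (indep_in A) w.
Proof.
move=> wA wv w_leaf; apply/setP => s.
rewrite [LHS]inE [RHS]inE indep_in_cons wA.
have [/indep_inP[_ /subsetP sA]|//] := boolP (s \in indep_in A).
apply/idP/forall_inP=> /= [v_s x xs|ws].
  by apply: contra v_s => /(w_leaf x (sA x xs)) <-.
by apply: contraL wv => /ws.
Qed.

Lemma indep_in_edgeless (G : sgraph) (A : {set G}) :
  (forall x y, x \in A -> y \in A -> ~~ adj x y) -> indep_in A = powerset A.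
Proof.
move=> noedge; apply/setP => s; rewrite powersetE.
apply/indep_inP/idP=> [[]//|sA]; split=> // x y xs ys.
by apply: noedge; apply: (subsetP sA).
Qed.

Lemma indep_in_svd (G : sgraph) (A : {set G}) :
  forest G -> s_vertex_decomposable (indep_in A).
Proof.
move=> hG; have [n] := ubnP #|A|; elim: n A => // n IH A; rewrite ltnS => cardA.
have [|noedge] := boolP [exists x in A, exists y in A, adj x y].
  case/exists_inP=> a aA /exists_inP[b bA ab].
  have [w [v [wA vA wv w_leaf]]] := forest_leaf hG aA bA ab.
  have smaller (B : {set G}) : B \subset A :\ v -> #|B| < n.
    move=> BA; apply: leq_trans cardA; rewrite (cardsD1 v A) vA.
    exact: subset_leq_card.
  apply: (@svd_step _ _ v w); try exact: vertex_indep_in.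
  - exact: indep_in_complex.
  - by rewrite deletion_indep_in; apply/IH/smaller.
  - rewrite link_indep_in //; apply/IH/smaller/subsetP => x.
    by rewrite !inE => /and3P[-> ->].
  - exact: deletion_eq_star_leaf.
rewrite indep_in_edgeless; last first.
  move=> x y xA yA; apply: contra noedge => xy.
  by apply/exists_inP; exists x => //; apply/exists_inP; exists y.
have [->|A0] := eqVneq A set0; first by rewrite powerset0; apply: svd_empty.
by apply: svd_simplex; exists A.
Qed.

Theorem theorem3p2 (G : sgraph) (hG : forest G) :
  s_vertex_decomposable (independence_complex G).
Proof.
have <- : indep_in setT = independence_complex G.
  by apply/setP => s; rewrite inE subsetT andbT.
exact: indep_in_svd.
Qed.
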